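(* Let $\mathcal{X}=\{\mathbf{x}_1,\ldots,\mathbf{x}_K\}\subseteq\mathbb{R}^d$ be a finite set of experiments spanning $\mathbb{R}^d$, let $L=\max_{\mathbf{x}\in\mathcal{X}}\|\mathbf{x}\|^2$, and let $\mu_G^\star\in\Delta_K$ be a solution of the relaxed G-optimal design problem. Let $\mathbf{X}_1,\ldots,\mathbf{X}_n$ be $n$ i.i.d. random matrices drawn according to $\mu_G^\star$ and let $\mathbf{S}_{G,n}=\sum_{i=1}^n\mathbf{X}_i$. Let $\mathbf{V}=\mathbb{E}[\mathbf{X}_1^2]-\mathbf{M}(\mu_G^\star)^2$, assume that $\mathbf{V}$ is not a scalar multiple of the identity, and let $\kappa=\|\mathbf{V}\|/\lambda_{\min}(\mathbf{V})$ be its condition number (with $\kappa^{-1}=0$ if $\lambda_{\min}(\mathbf{V})=0$). Let $\sigma^2=L^2\sum_{k=1}^K[\mu_G^\star]_k(1-[\mu_G^\star]_k)$ and $$\tilde d=\tilde d_n=\overline{\dim}(\mathbf{V})+\underline{\dim}(\mathbf{V})\,e^{-n(1-\kappa^{-1})/16}<d .$$ Let $0<\delta\le1$. Then there is a deterministic real sequence $(r_n)_n$ with $r_n=o(1/\sqrt{n})$ as $n\to\infty$ (with $\mathcal{X}$, $\mu_G^\star$ and $\delta$ fixed) such that, for all sufficiently large $n$ satisfying $$n\ge\frac{4L^2}{9\|\mathbf{V}\|}\log(\tilde d/\delta),$$ with probability at least $1-2\delta$, $$f_G\big(\mathbf{S}_{G,n}^{-1}\big)\le\left(1+\frac{L}{d}\,\|\mathbf{M}(\mu_G^\star)^{-1}\|^2\sqrt{\frac{4\sigma^2}{n}\log(\tilde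 d/\delta)}+r_n\right)f_{G,n}^\star .$$
   Context: $\|\cdot\|$ is the Euclidean norm for vectors and the spectral (operator) norm for matrices; $\lambda_{\min}$ is the smallest eigenvalue. $\Delta_K=\{\mu\in[0,1]^K:\sum_{k=1}^K[\mu]_k=1\}$, where $[\mu]_k$ is the $k$-th coordinate of $\mu$. For $\mu\in\Delta_K$, $\mathbf{M}(\mu)=\sum_{k=1}^K[\mu]_k\,\mathbf{x}_k\mathbf{x}_k^\top$. For a $d\times d$ positive semidefinite matrix $\mathbf{A}$, $f_G(\mathbf{A})=\max_{\mathbf{x}\in\mathcal{X}}\mathbf{x}^\top\mathbf{A}\mathbf{x}$. The relaxed G-optimal design problem is to minimize $f_G(\mathbf{M}(\mu)^{-1})$ over those $\mu\in\Delta_K$ for which $\mathbf{M}(\mu)$ is invertible. For a sample size $n$, $f_{G,n}^\star=f_G\big((n\mathbf{M}(\mu_G^\star))^{-1}\big)$. A random matrix drawn from $\mu\in\Delta_K$ is a random matrix equal to $\mathbf{x}_k\mathbf{x}_k^\top$, where the index $k$ is chosen with probability $[\mu]_k$. By convention, $f_G(\mathbf{S}^{-1})=+\infty$ when $\mathbf{S}$ is singular. For a $d\times d$ positive semidefinite matrix $\mathbf{A}$ that is not a scalar multiple of the identity $\mathbf{I}$, the upper and lower intrinsic dimensions are $$\overline{\dim}(\mathbf{A})=\frac{\operatorname{tr}(\mathbf{A}-\lambda_{\min}(\mathbf{A})\mathbf{I})}{\|\mathbf{A}\|-\lambda_{\min}(\mathbf{A})},\qquad \underline{\dim}(\mathbf{A})=\frac{\operatorname{tr}(\|\mathbf{A}\|\mathbf{I}-\mathbf{A})}{\|\mathbf{A}\|-\lambda_{\min}(\mathbf{A})}=d-\overline{\dim}(\mathbf{A}).$$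 *)

(* Defs.v *)
From HB Require Import structures.
From mathcomp Require Import all_boot all_order all_algebra.
From mathcomp Require Import all_classical all_reals all_analysis.
Set Implicit Arguments.
Unset Strict Implicit.
Unset Printing Implicit Defensive.
Import Order.TTheory GRing.Theory Num.Theory.
Import numFieldNormedType.Exports.
Local Open Scope classical_set_scope.
Local Open Scope ring_scope.

Section Matrices.
Context {R : realType} {d : nat}.
Implicit Types A : 'M[R]_d.

(* The norm that MathComp-Analysis puts on matrices is the max norm, hence
   the Euclidean and spectral norms below. *)
Definition l2norm (v : 'cV[R]_d) : R := Num.sqrt (\sum_(i < d) v i 0 ^+ 2).

Definition spectral_norm A : R :=
  sup [set l2norm (A *m v) | v in [set v : 'cV[R]_d | l2norm v <= 1]].

(* Used for symmetric A and 0 < d only: the set of eigenvalues is then finite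
   and nonempty, so that the infimum is a minimum. *)
Definition lambda_min A : R := inf [set a | eigenvalue A a].

Definition upper_dim A : R :=
  \tr (A - (lambda_min A)%:M) / (spectral_norm A - lambda_min A).

Definition lower_dim A : R :=
  \tr ((spectral_norm A)%:M - A) / (spectral_norm A - lambda_min A).

(* When lambda_min A = 0, x / 0 = 0 and 0^-1 = 0 give (cond_number A)^-1 = 0. *)
Definition cond_number A : R := spectral_norm A / lambda_min A.

End Matrices.

Section Design.
Context {R : realType} {d K : nat}.
Variable x : 'I_K -> 'cV[R]_d.
Implicit Types (mu : 'I_K -> R) (A S : 'M[R]_d).

Definition spanning : Prop := (<<[seq x k | k : 'I_K]>> = fullv)%VS.

Definition max_sqnorm : R := \big[Num.max/0]_(k < K) l2norm (x k) ^+ 2.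

Definition simplex : set ('I_K -> R) :=
  [set mu | (forall k, 0 <= mu k <= 1) /\ \sum_k mu k = 1].

Definition outer (k : 'I_K) : 'M[R]_d := x k *m (x k)^T.

Definition info_mx mu : 'M[R]_d := \sum_k mu k *: outer k.

(* The neutral element 0 is harmless: f_G is only applied to positive
   semidefinite matrices, for which all the values are nonnegative. *)
Definition fG A : R := \big[Num.max/0]_(k < K) ((x k)^T *m A *m x k) 0 0.

(* S |-> f_G(S^-1), with value +oo at singular matrices. *)
Definition fG_inv S : \bar R :=
  if S \in unitmx then (fG (invmx S))%:E else +oo%E.

Definition G_optimal mu : Prop :=
  [/\ simplex mu, info_mx mu \in unitmx &
      forall nu, simplex nu -> info_mx nu \in unitmx ->
        fG (invmx (info_mx mu)) <= fG (invmx (info_mx nu))].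

Definition fG_star mu (n : nat) : R := fG (invmx (n%:R *: info_mx mu)).

Definition drawn_from mu disp (Omega : measurableType disp)
    (P : probability Omega R) (X : Omega -> 'M[R]_d) : Prop :=
  exists idx : Omega -> 'I_K,
    [/\ forall k, measurable (idx @^-1` [set k]),
        forall k, P (idx @^-1` [set k]) = (mu k)%:E &
        forall w, X w = outer (idx w)].

(* E[X^2] for X drawn from mu; see drawn_from_second_moment. *)
Definition second_moment mu : 'M[R]_d :=
  \sum_k mu k *: (outer k *m outer k).

Definition variance_mx mu : 'M[R]_d :=
  second_moment mu - info_mx mu *m info_mx mu.

Definition sigma2 mu : R := max_sqnorm ^+ 2 * \sum_k mu k * (1 - mu k).

Definition dtilde mu (n : nat) : R :=
  let V := variance_mx mu in
  upper_dim V +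
  lower_dim V * expR (- (n%:R * (1 - (cond_number V)^-1) / 16)).

End Design.

(* Mutual independence of X_1, ..., X_n for variables with finitely many
   values: all the preimages are then events, so that B ranges over arbitrary
   subsets. Subfamilies are obtained by taking B i = setT. *)
Definition mutually_independent {R : realType} disp
    (Omega : measurableType disp) (P : probability Omega R) (U : Type)
    (n : nat) (X : 'I_n -> Omega -> U) : Prop :=
  forall B : 'I_n -> set U,
    P (\bigcap_(i in [set: 'I_n]) (X i @^-1` B i)) =
    (\prod_(i < n) P (X i @^-1` B i))%E.

Definition iid_draws {R : realType} {d K : nat} (x : 'I_K -> 'cV[R]_d)
    (mu : 'I_K -> R) disp (Omega : measurableType disp)
    (P : probability Omega R) (n : nat) (X : 'I_n -> Omega -> 'M[R]_d) : Prop :=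
  (forall i, drawn_from x mu P (X i)) /\ mutually_independent P X.

Section Moments.
Context {R : realType} {d K : nat}.
Variables (x : 'I_K -> 'cV[R]_d) (mu : 'I_K -> R).
Context disp (Omega : measurableType disp) (P : probability Omega R).

Lemma drawn_index_expectation (idx : Omega -> 'I_K) (f : 'I_K -> R) :
  (forall k, measurable (idx @^-1` [set k])) ->
  (forall k, P (idx @^-1` [set k]) = (mu k)%:E) ->
  ('E_P[fun w => f (idx w)] = (\sum_k mu k * f k)%:E)%E.
Proof.
move=> mk Pk; rewrite unlock.
have fE w : (f (idx w))%:E =
    (\sum_(k < K) (f k)%:E * (\1_(idx @^-1` [set k]) w)%:E)%E.
  rewrite (bigD1 (idx w)) //= big1 ?adde0 => [|k kNw].
    by rewrite indicE mem_set // mule1.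
  rewrite indicE memNset ?mule0 // => /= kE.
  by rewrite kE eqxx in kNw.
have int1 k : P.-integrable setT (EFin \o \1_(idx @^-1` [set k])).
  exact: integrable_indic.
under eq_integral do rewrite fE.
have intZ k : P.-integrable setT
    (fun w => (f k)%:E * (\1_(idx @^-1` [set k]) w)%:E)%E.
  by apply: integrableZl => //; exact: int1.
rewrite integral_sum //.
rewrite -sumEFin; apply: eq_bigr => k _.
rewrite (integralZl measurableT (int1 k)) integral_indic // setIT.
by rewrite [X in (_ * X)%E]Pk -EFinM mulrC.
Qed.

Lemma drawn_from_mean (X : Omega -> 'M[R]_d) (i j : 'I_d) :
  drawn_from x mu P X ->
  ('E_P[fun w => X w i j] = (info_mx x mu i j)%:E)%E.
Proof.
move=> [idx [mk Pk XE]].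
have -> : X = outer x \o idx by apply/funext.
rewrite (drawn_index_expectation (fun k => outer x k i j) mk Pk).
by congr EFin; rewrite summxE; apply: eq_bigr => k _; rewrite [RHS]mxE.
Qed.

Lemma drawn_from_second_moment (X : Omega -> 'M[R]_d) (i j : 'I_d) :
  drawn_from x mu P X ->
  ('E_P[fun w => (X w *m X w) i j] = (second_moment x mu i j)%:E)%E.
Proof.
move=> [idx [mk Pk XE]].
have -> : X = outer x \o idx by apply/funext.
rewrite (drawn_index_expectation (fun k => (outer x k *m outer x k) i j) mk Pk).
by congr EFin; rewrite summxE; apply: eq_bigr => k _; rewrite [RHS]mxE.
Qed.

End Moments.

(* Main.v *)
(* The deviation of S/n from M is measured in the Frobenius norm. A centred
   draw X - M has E |X - M|_F^2 = tr V <= sigma^2, so a dimension-free vector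
   Bernstein inequality applies: for W = S - nM,
     E cosh (lam |W|_F) <= exp (n lam^2 sigma^2)      (lam small),
   because cosh o sqrt is convex. With eps = sqrt (4 sigma^2 ln (dt/delta) / n)
   and lam = eps / (2 sigma^2), Markov's inequality gives
     P (|W|_F > n eps) <= 2 exp (- ln (dt/delta)) = 2 delta / dt <= 2 delta,
   since upper_dim V >= 1. On the complementary event, with b = |M^-1|,
     x^T (S/n)^-1 x <= x^T M^-1 x + L (b^2 eps + 2 b^3 eps^2),
   and fG_star >= d/n converts the additive error into a relative one; the
   term in eps^2 is O(1/n). *)

Require Import Defs.
From HB Require Import structures.
From mathcomp Require Import all_boot all_order all_algebra.
From mathcomp Require Import all_classical all_reals all_analysis.
From mathcomp Require Import ring lra.
Set Implicit Arguments.
Unset Strict Implicit.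
Unset Printing Implicit Defensive.
Import Order.TTheory GRing.Theory Num.Theory.
Import numFieldNormedType.Exports.
Local Open Scope classical_set_scope.
Local Open Scope ring_scope.

(** * Frobenius inner product and positive semidefinite matrices *)

(** Only semidefiniteness is assumed, so that the result covers both [fdot] and the possibly
    degenerate form of a positive semidefinite matrix. *)
Lemma form_cauchy_schwarz (R : realFieldType) (V : lmodType R) (b : V -> V -> R) :
  (forall a u v w, b (a *: u + v) w = a * b u w + b v w) ->
  (forall u v, b u v = b v u) -> (forall u, 0 <= b u u) ->
  forall u v, b u v ^+ 2 <= b u u * b v v.
Proof.
move=> bL bC b0 u v.
have bq a : b (a *: u + v) (a *: u + v) = a ^+ 2 * b u u + 2 * a * b u v + b v v.
  by rewrite bL (bC u) (bC v) !bL (bC v u); ring.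
have := b0 u; rewrite le_eqVlt => /predU1P[/esym uu0|uu0].
  suff -> : b u v = 0 by rewrite uu0 mul0r expr0n.
  apply/eqP/negP => /negP uv0.
  (* When [b u u = 0] the form is affine in the coefficient of [u]; this coefficient gives it the
     value -1. *)
  have := b0 ((- (b v v + 1) / (2 * b u v)) *: u + v).
  rewrite bq uu0 mulr0 add0r.
  have -> : 2 * (- (b v v + 1) / (2 * b u v)) * b u v = - (b v v + 1) by field.
  lra.
(* The coefficient minimising the quadratic [bq]. *)
have := b0 ((- b u v / b u u) *: u + v); rewrite bq.
have -> : (- b u v / b u u) ^+ 2 * b u u + 2 * (- b u v / b u u) * b u v + b v v
   = (b u u * b v v - b u v ^+ 2) / b u u by field; rewrite gt_eqF.
by rewrite pmulr_lge0 ?invr_gt0// subr_ge0.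
Qed.

Section Frobenius.
Context {R : realType}.

Definition fdot m n (A B : 'M[R]_(m, n)) : R := \tr (A *m B^T).
Definition fnorm m n (A : 'M[R]_(m, n)) : R := Num.sqrt (fdot A A).

Lemma fdotC m n (A B : 'M[R]_(m, n)) : fdot A B = fdot B A.
Proof. by rewrite /fdot -mxtrace_tr trmx_mul trmxK. Qed.

Lemma fdotDl m n (A B C : 'M[R]_(m, n)) : fdot (A + B) C = fdot A C + fdot B C.
Proof. by rewrite /fdot mulmxDl mxtraceD. Qed.

Lemma fdotZl m n a (A C : 'M[R]_(m, n)) : fdot (a *: A) C = a * fdot A C.
Proof. by rewrite /fdot -scalemxAl mxtraceZ. Qed.

Lemma fdotNl m n (A C : 'M[R]_(m, n)) : fdot (- A) C = - fdot A C.
Proof. by rewrite -scaleN1r fdotZl mulN1r. Qed.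

Lemma fdotDr m n (A B C : 'M[R]_(m, n)) : fdot C (A + B) = fdot C A + fdot C B.
Proof. by rewrite fdotC fdotDl !(fdotC C). Qed.

Lemma fdotZr m n a (A C : 'M[R]_(m, n)) : fdot C (a *: A) = a * fdot C A.
Proof. by rewrite fdotC fdotZl fdotC. Qed.

Lemma fdotNr m n (A C : 'M[R]_(m, n)) : fdot C (- A) = - fdot C A.
Proof. by rewrite fdotC fdotNl fdotC. Qed.

Lemma fdot0l m n (C : 'M[R]_(m, n)) : fdot 0 C = 0.
Proof. by rewrite /fdot mul0mx mxtrace0. Qed.

Lemma fdot_suml m n (I : finType) (F : I -> 'M[R]_(m, n)) C :
  fdot (\sum_i F i) C = \sum_i fdot (F i) C.
Proof. by rewrite /fdot mulmx_suml raddf_sum. Qed.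

Lemma fdotE m n (A B : 'M[R]_(m, n)) : fdot A B = \sum_i \sum_j A i j * B i j.
Proof.
apply: eq_bigr => i _; rewrite mxE; apply: eq_bigr => j _; by rewrite mxE.
Qed.

Lemma fdot_ge0 m n (A : 'M[R]_(m, n)) : 0 <= fdot A A.
Proof. by rewrite fdotE; do 2 (apply: sumr_ge0 => ? _); rewrite -expr2 sqr_ge0. Qed.

Lemma fdot_eq0 m n (A : 'M[R]_(m, n)) : fdot A A = 0 -> A = 0.
Proof.
rewrite fdotE => A0; apply/matrixP => i j; rewrite mxE.
have h i' : 0 <= \sum_j A i' j * A i' j.
  by apply: sumr_ge0 => ? _; rewrite -expr2 sqr_ge0.
have /(_ i isT) /eqP := psumr_eq0P (fun i' _ => h i') A0.
rewrite psumr_eq0 => [/allP/(_ j (mem_index_enum _))|? _]; last first.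
  by rewrite -expr2 sqr_ge0.
by rewrite mulf_eq0 orbb => /eqP.
Qed.

Lemma fdot_mulmxl m n p (A : 'M[R]_(m, n)) (B : 'M[R]_(n, p)) C :
  fdot (A *m B) C = fdot B (A^T *m C).
Proof.
by rewrite /fdot trmx_mul trmxK mulmxA [RHS]mxtrace_mulC mulmxA.
Qed.

Lemma fdot_colE n (u v : 'cV[R]_n) : fdot u v = (u^T *m v) 0 0.
Proof. by rewrite /fdot mxtrace_mulC -trace_mx11 -mxtrace_tr trmx_mul trmxK. Qed.

Lemma fdot_cauchy_schwarz m n (A B : 'M[R]_(m, n)) :
  fdot A B ^+ 2 <= fdot A A * fdot B B.
Proof.
apply: (@form_cauchy_schwarz R _ (@fdot m n)) => *.
- by rewrite fdotDl fdotZl.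
- exact: fdotC.
- exact: fdot_ge0.
Qed.

Lemma fnorm_ge0 m n (A : 'M[R]_(m, n)) : 0 <= fnorm A.
Proof. exact: sqrtr_ge0. Qed.

Lemma sqr_fnorm m n (A : 'M[R]_(m, n)) : fnorm A ^+ 2 = fdot A A.
Proof. by rewrite sqr_sqrtr// fdot_ge0. Qed.

Lemma fnorm_eq0 m n (A : 'M[R]_(m, n)) : fnorm A = 0 -> A = 0.
Proof. by move=> A0; apply: fdot_eq0; rewrite -sqr_fnorm A0 expr0n. Qed.

Lemma fnormZ m n a (A : 'M[R]_(m, n)) : fnorm (a *: A) = `|a| * fnorm A.
Proof.
by rewrite /fnorm fdotZl fdotZr mulrA -expr2 sqrtrM ?sqr_ge0// sqrtr_sqr.
Qed.

Lemma fnormN m n (A : 'M[R]_(m, n)) : fnorm (- A) = fnorm A.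
Proof. by rewrite /fnorm fdotNl fdotNr opprK. Qed.

Lemma ler_fdot_fnorm m n (A B : 'M[R]_(m, n)) : `|fdot A B| <= fnorm A * fnorm B.
Proof.
rewrite -ler_sqr ?nnegrE ?mulr_ge0 ?fnorm_ge0//.
by rewrite exprMn !sqr_fnorm real_normK ?num_real// fdot_cauchy_schwarz.
Qed.

Lemma ler_fnormD m n (A B : 'M[R]_(m, n)) : fnorm (A + B) <= fnorm A + fnorm B.
Proof.
rewrite -ler_sqr ?nnegrE ?addr_ge0 ?fnorm_ge0// sqrrD !sqr_fnorm.
rewrite fdotDl !fdotDr (fdotC B A).
have := le_trans (ler_norm _) (ler_fdot_fnorm A B).
rewrite mulr2n; lra.
Qed.

Lemma ler_fnormB m n (A B : 'M[R]_(m, n)) : fnorm (A - B) <= fnorm A + fnorm B.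
Proof. by rewrite (le_trans (ler_fnormD _ _))// fnormN. Qed.

Lemma ler_fnormM m n p (A : 'M[R]_(m, n)) (B : 'M[R]_(n, p)) :
  fnorm (A *m B) <= fnorm A * fnorm B.
Proof.
rewrite -ler_sqr ?nnegrE ?mulr_ge0 ?fnorm_ge0// exprMn !sqr_fnorm.
rewrite !fdotE mulr_suml ler_sum// => i _.
rewrite exchange_big/= mulr_sumr ler_sum// => k _.
(* Each entry of the product pairs a row with a column; Cauchy-Schwarz is applied entry by entry. *)
have := fdot_cauchy_schwarz (row i A) (row k B^T).
rewrite !fdotE !big_ord1.
have -> : \sum_j row i A ord0 j * row k B^T ord0 j = (A *m B) i k.
  by rewrite mxE; apply: eq_bigr => j _; rewrite !mxE.
have -> : \sum_j row i A ord0 j * row i A ord0 j = \sum_j A i j * A i j.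
  by apply: eq_bigr => j _; rewrite !mxE.
have -> : \sum_j row k B^T ord0 j * row k B^T ord0 j = \sum_j B j k * B j k.
  by apply: eq_bigr => j _; rewrite !mxE.
by rewrite expr2.
Qed.

Lemma l2normE n (v : 'cV[R]_n) : l2norm v = fnorm v.
Proof.
by congr Num.sqrt; rewrite fdotE; apply: eq_bigr => i _; rewrite big_ord1 expr2.
Qed.

End Frobenius.

(** * Spectral norm and positive semidefinite forms *)

Section Spectral.
Context {R : realType} {d : nat}.
Implicit Types (A Q : 'M[R]_d) (v : 'cV[R]_d).

Let ball_set A := [set l2norm (A *m v) | v in [set v : 'cV[R]_d | l2norm v <= 1]].

Let ball_set0 A : ball_set A !=set0.
Proof.
exists (l2norm (A *m 0)), 0 => //=.
by rewrite l2normE /fnorm fdot0l sqrtr0.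
Qed.

(** The Frobenius norm is a bound, so the [sup] in [spectral_norm] is a genuine supremum. *)
Let ball_setub A : has_ubound (ball_set A).
Proof.
exists (fnorm A) => _ [v /= v1 <-].
rewrite l2normE (le_trans (ler_fnormM _ _))//.
by rewrite ler_piMr ?fnorm_ge0// -l2normE.
Qed.

Lemma fnorm_mulmx_spectral A v : fnorm (A *m v) <= spectral_norm A * fnorm v.
Proof.
have := fnorm_ge0 v; rewrite le_eqVlt => /predU1P[/esym v0|v0].
  by rewrite (fnorm_eq0 v0) mulmx0 /fnorm fdot0l sqrtr0 mulr0.
rewrite -ler_pdivrMr//.
apply: (ub_le_sup (ball_setub A)).
exists ((fnorm v)^-1 *: v); rewrite /= l2normE.
  by rewrite fnormZ ger0_norm ?invr_ge0 ?fnorm_ge0// mulVf ?gt_eqF.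
by rewrite -scalemxAr fnormZ ger0_norm ?invr_ge0 ?fnorm_ge0// mulrC.
Qed.

Lemma spectral_norm_le A c : (forall v, fnorm (A *m v) <= c * fnorm v) ->
  0 <= c -> spectral_norm A <= c.
Proof.
move=> Ac c0; apply: ge_sup => [|_ [v /= v1 <-]]; first exact: ball_set0.
by rewrite l2normE (le_trans (Ac v))// ler_piMr// -l2normE.
Qed.

Lemma spectral_norm_ge0 A : 0 <= spectral_norm A.
Proof.
apply: (le_trans (sqrtr_ge0 _)); apply: (ub_le_sup (ball_setub A)).
by exists 0 => //=; rewrite l2normE /fnorm fdot0l sqrtr0.
Qed.

Definition psd Q := Q^T = Q /\ forall v, 0 <= fdot (Q *m v) v.

Lemma psd_cauchy_schwarz Q u v : psd Q ->
  fdot (Q *m u) v ^+ 2 <= fdot (Q *m u) u * fdot (Q *m v) v.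
Proof.
move=> [Qs Q0].
apply: (@form_cauchy_schwarz R _ (fun u v => fdot (Q *m u) v)) => //.
- by move=> a w y z; rewrite mulmxDr -scalemxAr fdotDl fdotZl.
- by move=> w y; rewrite fdot_mulmxl Qs fdotC.
Qed.

Lemma fdot_delta Q i j :
  fdot (Q *m delta_mx i 0 : 'cV_d) (delta_mx j 0) = Q j i.
Proof.
by rewrite -colE fdotC fdot_colE trmx_delta -rowE !mxE.
Qed.

Lemma psd_diag_ge0 Q i : psd Q -> 0 <= Q i i.
Proof. by move=> [_ /(_ (delta_mx i 0))]; rewrite fdot_delta. Qed.

Lemma psd_trace_ge0 Q : psd Q -> 0 <= \tr Q.
Proof. by move=> Qp; apply: sumr_ge0 => i _; exact: psd_diag_ge0. Qed.

(** Cauchy-Schwarz on basis vectors bounds the square of each entry [Q i j] by [Q i i * Q j j];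
    these products sum to the squared trace. *)
Lemma psd_fnorm_le_trace Q : psd Q -> fnorm Q <= \tr Q.
Proof.
move=> Qp; rewrite -ler_sqr ?nnegrE ?fnorm_ge0 ?psd_trace_ge0// sqr_fnorm fdotE.
rewrite expr2 mulr_suml ler_sum// => i _; rewrite mulr_sumr ler_sum// => j _.
by have := psd_cauchy_schwarz (delta_mx j 0) (delta_mx i 0) Qp;
  rewrite !fdot_delta expr2 mulrC (mulrC (Q i i)) mulrC.
Qed.

Lemma psd_trace_eq0 Q : psd Q -> \tr Q = 0 -> Q = 0.
Proof.
move=> Qp Q0; apply: fnorm_eq0; apply/eqP.
by rewrite eq_le fnorm_ge0 andbT -Q0 psd_fnorm_le_trace.
Qed.

(* Cauchy-Schwarz for the form of Q, applied to v and Q^-1 v. *)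
Lemma psd_unit_coercive Q : psd Q -> Q \in unitmx ->
  exists2 c, 0 < c & forall v, c * fdot v v <= fdot (Q *m v) v.
Proof.
move=> Qp Qu; set b := fnorm (invmx Q).
have b0 : 0 < 1 + b by rewrite (lt_le_trans ltr01)// lerDl fnorm_ge0.
exists (1 + b)^-1 => [|v]; first by rewrite invr_gt0.
have := fdot_ge0 v; rewrite le_eqVlt => /predU1P[<-|v0].
  by rewrite mulr0 Qp.2.
rewrite mulrC ler_pdivrMr//.
have := psd_cauchy_schwarz (invmx Q *m v) v Qp.
rewrite !mulmxA mulmxV// mul1mx => h.
have h2 : fdot v (invmx Q *m v) <= b * fdot v v.
  rewrite (le_trans (ler_norm _))// (le_trans (ler_fdot_fnorm _ _))//.
  rewrite (le_trans (ler_wpM2l (fnorm_ge0 _) (ler_fnormM _ _)))//.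
  by rewrite mulrCA -expr2 sqr_fnorm.
have h3 : fdot v v ^+ 2 <= (b * fdot v v) * fdot (Q *m v) v.
  by rewrite (le_trans h)// ler_wpM2r// Qp.2.
have h4 : fdot v v <= b * fdot (Q *m v) v.
  by rewrite -(ler_pM2l v0) -expr2 (le_trans h3)// mulrAC mulrC.
by rewrite (le_trans h4)// mulrC ler_wpM2l ?Qp.2// lerDr.
Qed.

End Spectral.

(** * Hyperbolic cosine of a norm *)

Section Cosh.
Context {R : realType}.
Implicit Types (x y p q : R).

Definition cosh x : R := (expR x + expR (- x)) / 2.
Definition sinh x : R := (expR x - expR (- x)) / 2.

Lemma coshD x y : cosh (x + y) = cosh x * cosh y + sinh x * sinh y.
Proof. by rewrite /cosh /sinh opprD !expRD; field. Qed.

Lemma coshB x y : cosh (x - y) = cosh x * cosh y - sinh x * sinh y.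
Proof. by rewrite /cosh /sinh opprD !expRD opprK; field. Qed.

Lemma cosh_gt0 x : 0 < cosh x.
Proof. by rewrite divr_gt0// addr_gt0// expR_gt0. Qed.

Lemma cosh0 : cosh 0 = 1.
Proof. by rewrite /cosh oppr0 expR0; field. Qed.

Lemma cosh_norm x : cosh `|x| = cosh x.
Proof. by rewrite /cosh; case: (ger0P x) => _; rewrite // opprK addrC. Qed.

Lemma cosh_geE x : expR x / 2 <= cosh x.
Proof. by rewrite ler_pM2r ?invr_gt0// lerDl expR_ge0. Qed.

Lemma sinh_le_cosh x : sinh x <= cosh x.
Proof. by rewrite ler_pM2r ?invr_gt0// lerD2l ge0_cp ?expR_ge0. Qed.

Lemma expR_cosh_sinh x : cosh x + sinh x = expR x.
Proof. by rewrite /cosh /sinh; field. Qed.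

Lemma power_convex (a p q : R) n : 0 <= a <= 1 -> 0 <= p -> 0 <= q ->
  (a * p + (1 - a) * q) ^+ n <= a * p ^+ n + (1 - a) * q ^+ n.
Proof.
move=> /andP[a0 a1] p0 q0; elim: n => [|n IH]; first by rewrite !expr0; lra.
rewrite !exprS.
have c0 : 0 <= a * p + (1 - a) * q by rewrite addr_ge0 ?mulr_ge0// subr_ge0.
rewrite (le_trans (ler_wpM2l c0 IH))// -subr_ge0.
(* The gap is a Chebyshev product: [p - q] and [p ^+ n - q ^+ n] have the same sign. *)
have -> : a * (p * p ^+ n) + (1 - a) * (q * q ^+ n) -
   (a * p + (1 - a) * q) * (a * p ^+ n + (1 - a) * q ^+ n) =
   a * (1 - a) * ((p - q) * (p ^+ n - q ^+ n)) by ring.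
apply: mulr_ge0; first by rewrite mulr_ge0// subr_ge0.
have [pq|/ltW qp] := lerP p q.
  by rewrite mulr_le0// subr_le0// lerXn2r.
by rewrite mulr_ge0// subr_ge0// lerXn2r.
Qed.

(** Cutting at even indices keeps consecutive terms in pairs, so that the partial sums at [x] and
    [- x] combine into those of [cosh] and [sinh]. *)
Lemma cvg_exp_even_series x :
  (fun n => series (exp_coeff x) n.*2) @ \oo --> expR x.
Proof.
have dbl : (fun n => n.*2) @ \oo --> \oo.
  move=> A [N _ NA]; exists N => // n /= Nn; apply: NA => /=.
  by rewrite (leq_trans Nn)// -addnn leq_addr.
exact: cvg_comp dbl (is_cvg_series_exp_coeff _).
Qed.

(** Written in powers of [x ^+ 2], to show cosh of a square root as a power series with nonnegative
    coefficients. *)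
Lemma cvg_cosh_series x :
  (fun n => \sum_(0 <= m < n) (x ^+ 2) ^+ m / (m.*2)`!%:R) @ \oo --> cosh x.
Proof.
have D := @cvg_exp_even_series.
have : (fun n => (series (exp_coeff x) n.*2 + series (exp_coeff (- x)) n.*2) / 2)
    @ \oo --> cosh x.
  apply: cvgMr_tmp; exact: cvgD.
apply: cvg_trans; apply: near_eq_cvg; apply: nearW => n.
rewrite /series/=; elim: n => [|n IH]; first by rewrite double0 !big_geq// addr0 mul0r.
rewrite doubleS !(big_nat_recr n.*2.+1)//= !(big_nat_recr n.*2)//= (big_nat_recr n)//=.
rewrite -IH /exp_coeff/=.
rewrite !(exprS _ n.*2).
have -> : (- x) ^+ n.*2 = x ^+ n.*2 by rewrite -mul2n !exprM sqrrN.
rewrite -(exprM x 2) mul2n !mulNr.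
move: (\sum_(_ <= _ < _) _) (\sum_(_ <= _ < _) _) (_ ^+ _ / _) (x * _ / _) => a b e f.
by field.
Qed.

Lemma cvg_sinh_series x :
  (fun n => \sum_(0 <= m < n) x * (x ^+ 2) ^+ m / (m.*2.+1)`!%:R) @ \oo --> sinh x.
Proof.
have D := @cvg_exp_even_series.
have : (fun n => (series (exp_coeff x) n.*2 - series (exp_coeff (- x)) n.*2) / 2)
    @ \oo --> sinh x.
  by apply: cvgMr_tmp; exact: cvgB.
apply: cvg_trans; apply: near_eq_cvg; apply: nearW => n.
rewrite /series/=; elim: n => [|n IH]; first by rewrite double0 !big_geq// subr0 mul0r.
rewrite doubleS !(big_nat_recr n.*2.+1)//= !(big_nat_recr n.*2)//= (big_nat_recr n)//=.
rewrite -IH /exp_coeff/= !(exprS _ n.*2).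
have -> : (- x) ^+ n.*2 = x ^+ n.*2 by rewrite -mul2n !exprM sqrrN.
rewrite -(exprM x 2) mul2n !mulNr.
move: (\sum_(_ <= _ < _) _) (\sum_(_ <= _ < _) _) (_ ^+ _ / _) (x * _ / _) => a b e f.
by field.
Qed.

Lemma le_sinh x : 0 <= x -> x <= sinh x.
Proof.
move=> x0; apply: (ler_cvg_to (cvg_cst x) (@cvg_sinh_series x)).
exists 1%N => // -[//|n] _ /=.
rewrite big_nat_recl//= expr0 !mulr1 invr1 mulr1 lerDl.
apply: sumr_ge0 => i _.
by rewrite mulr_ge0 ?invr_ge0 ?ler0n ?mulr_ge0// exprn_ge0 ?sqr_ge0.
Qed.

(** Every term of the series of cosh of a square root is a nonnegative multiple of a power, hence
    convex; the inequality passes to the limit. *)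
Lemma cosh_sqrt_convex (a p q : R) : 0 <= a <= 1 -> 0 <= p -> 0 <= q ->
  cosh (Num.sqrt (a * p + (1 - a) * q)) <=
  a * cosh (Num.sqrt p) + (1 - a) * cosh (Num.sqrt q).
Proof.
move=> a01 p0 q0; have /andP[a0 a1] := a01.
have c0 : 0 <= a * p + (1 - a) * q by rewrite addr_ge0 ?mulr_ge0// subr_ge0.
have C y z : (fun n => y * \sum_(0 <= m < n) (z ^+ 2) ^+ m / (m.*2)`!%:R) @ \oo
    --> y * cosh z.
  by apply: cvgMl_tmp; exact: cvg_cosh_series.
apply: (ler_cvg_to (@cvg_cosh_series _)
  (cvgD (C a (Num.sqrt p)) (C (1 - a) (Num.sqrt q)))).
apply: nearW => n; rewrite !fctE.
rewrite !sqr_sqrtr// !mulr_sumr -big_split/=.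
apply: ler_sum => m _; rewrite !mulrA -mulrDl ler_wpM2r ?invr_ge0 ?ler0n//.
exact: power_convex.
Qed.

(** Squaring [1 - x / 2 <= expR (- (x / 2))] bounds [expR x] by the inverse of [(1 - x / 2) ^+ 2].
    The comparison then reduces to [0 <= 1 - 3 * x + x ^+ 2], which is where the threshold 1/3 comes
    from. *)
Lemma expR_le_quadratic x : 0 <= x <= 3^-1 -> expR x <= 1 + x + x ^+ 2.
Proof.
move=> /andP[x0 x1].
have h : expR x * (1 - x / 2) ^+ 2 <= 1.
  rewrite (_ : expR x = expR (x / 2) ^+ 2); last first.
    by rewrite expr2 -expRD; congr expR; field.
  rewrite -exprMn exprn_ile1 ?mulr_ge0 ?expR_ge0//; first by lra.
  have := expR_ge1Dx (- (x / 2)); rewrite expRN => h.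
  by rewrite mulrC -ler_pdivlMr ?expR_gt0// mul1r.
have k0 : 0 < (1 - x / 2) ^+ 2 by rewrite exprn_gt0//; lra.
rewrite -(ler_pM2r k0) (le_trans h)// -subr_ge0.
have -> : (1 + x + x ^+ 2) * (1 - x / 2) ^+ 2 - 1
  = x ^+ 2 / 4 * (1 - 3 * x + x ^+ 2) by field.
rewrite mulr_ge0 ?mulr_ge0 ?sqr_ge0//.
have := sqr_ge0 x; lra.
Qed.

End Cosh.

(* As a function of the cosine c of the angle between s and y, the left-hand
   side is convex and the right-hand side affine; at c = 1 and c = -1 the
   inequality follows from the addition formulas. *)
Lemma cosh_fnormD (R : realType) m n (s y : 'M[R]_(m, n)) :
  cosh (fnorm (s + y)) <= cosh (fnorm s) * (expR (fnorm y) - fnorm y) +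
    sinh (fnorm s) / fnorm s * fdot s y.
Proof.
set a := fnorm s; set b := fnorm y.
have a0 : 0 <= a := fnorm_ge0 s.
have b0 : 0 <= b := fnorm_ge0 y.
have eb : expR b - b = cosh b + (sinh b - b) by rewrite -expR_cosh_sinh; ring.
have sb : 0 <= sinh b - b by rewrite subr_ge0 le_sinh.
have sa0 : 0 <= sinh a := le_trans a0 (le_sinh a0).
have sc := sinh_le_cosh a.
have [s0|s0] := eqVneq s 0.
  rewrite s0 add0r fdot0l mulr0 addr0 eb -/b /a s0 /fnorm fdot0l sqrtr0 cosh0.
  by rewrite mul1r lerDl.
have [y0|y0] := eqVneq y 0.
  rewrite y0 addr0 /b y0 -[X in fdot s X](scale0r (0 : 'M[R]_(m, n))) fdotZr.
  by rewrite mul0r mulr0 addr0 /fnorm fdot0l sqrtr0 expR0 subr0 mulr1.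
have {s0}a0' : 0 < a.
  by rewrite lt_neqAle a0 andbT eq_sym; apply: contra s0 => /eqP/fnorm_eq0 ->.
have {y0}b0' : 0 < b.
  by rewrite lt_neqAle b0 andbT eq_sym; apply: contra y0 => /eqP/fnorm_eq0 ->.
have ab0 : 0 < a * b by rewrite mulr_gt0.
pose c := fdot s y / (a * b).
have fE : fdot s y = a * b * c by rewrite /c mulrCA mulfV ?mulr1// gt_eqF.
have c1 : -1 <= c <= 1.
  by rewrite -ler_norml normrM normfV (gtr0_norm ab0) ler_pdivrMr// mul1r
    ler_fdot_fnorm.
have al : 0 <= (1 + c) / 2 <= 1 by lra.
(* The squared norm is the convex combination, with weights [(1 + c) / 2] and [(1 - c) / 2], of its
   values for parallel and antiparallel vectors. *)
have nE : fdot (s + y) (s + y) =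
    (1 + c) / 2 * (a + b) ^+ 2 + (1 - (1 + c) / 2) * (a - b) ^+ 2.
  rewrite fdotDl !fdotDr (fdotC y s) -!sqr_fnorm -/a -/b fE.
  by field.
rewrite {1}/fnorm nE.
rewrite (le_trans (cosh_sqrt_convex al (sqr_ge0 _) (sqr_ge0 _)))//.
rewrite !sqrtr_sqr !cosh_norm coshD coshB fE eb.
have -> : sinh a / a * (a * b * c) = sinh a * b * c by field; rewrite gt_eqF.
rewrite -subr_ge0.
have -> : cosh a * (cosh b + (sinh b - b)) + sinh a * b * c -
  ((1 + c) / 2 * (cosh a * cosh b + sinh a * sinh b) +
   (1 - (1 + c) / 2) * (cosh a * cosh b - sinh a * sinh b))
  = (cosh a - c * sinh a) * (sinh b - b) by field.
rewrite mulr_ge0// subr_ge0 (le_trans _ sc)// ler_piMl//.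
by case/andP: c1.
Qed.

(** * Sums of independent matrices *)

Section ProductWeights.
Context {R : realType} {T : finType}.

Definition ffun_cons n (a : T) (j : {ffun 'I_n -> T}) : {ffun 'I_n.+1 -> T} :=
  [ffun i => oapp j a (unlift ord0 i)].

Lemma ffun_cons0 n a (j : {ffun 'I_n -> T}) : ffun_cons a j ord0 = a.
Proof. by rewrite ffunE unlift_none. Qed.

Lemma ffun_consS n a (j : {ffun 'I_n -> T}) i : ffun_cons a j (lift ord0 i) = j i.
Proof. by rewrite ffunE liftK. Qed.

Lemma sum_ffun_cons n (F : {ffun 'I_n.+1 -> T} -> R) :
  \sum_j F j = \sum_a \sum_(j : {ffun 'I_n -> T}) F (ffun_cons a j).
Proof.
rewrite pair_bigA /= (reindex (fun q => ffun_cons q.1 q.2))//.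
exists (fun j : {ffun 'I_n.+1 -> T} =>
  (j ord0, [ffun i : 'I_n => j (lift ord0 i)])) => [[a j] _|j _] /=.
  congr pair; first by rewrite ffun_cons0.
  by apply/ffunP => i; rewrite ffunE ffun_consS.
apply/ffunP => i; case: (unliftP ord0 i) => [k|] ->.
  by rewrite ffun_consS ffunE.
by rewrite ffun_cons0.
Qed.

Lemma sum_prod_ffun n (p : T -> R) : \sum_a p a = 1 ->
  \sum_(j : {ffun 'I_n -> T}) \prod_i p (j i) = 1.
Proof.
move=> p1; rewrite -(bigA_distr_bigA (fun _ : 'I_n => p)) /=.
by rewrite big1// => i _.
Qed.

Section Tail.
Variables (m k : nat) (p : T -> R) (Y : T -> 'M[R]_(m, k)) (v : R).
Hypothesis p_ge0 : forall a, 0 <= p a.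
Hypothesis p_sum1 : \sum_a p a = 1.
Hypothesis Y_centered : \sum_a p a *: Y a = 0.
Hypothesis Y_bounded : forall a, fnorm (Y a) <= 3^-1.
Hypothesis Y_variance : \sum_a p a * fnorm (Y a) ^+ 2 <= v.

(** The term of [cosh_fnormD] linear in [Y a] averages to zero by centring; the other is controlled
    by [expR b - b <= 1 + b ^+ 2], whose mean is at most [1 + v <= expR v]. *)
Lemma mean_cosh_step s :
  \sum_a p a * cosh (fnorm (s + Y a)) <= cosh (fnorm s) * expR v.
Proof.
have h a : p a * cosh (fnorm (s + Y a)) <=
   cosh (fnorm s) * (p a + p a * fnorm (Y a) ^+ 2) +
   sinh (fnorm s) / fnorm s * fdot (p a *: Y a) s.
  rewrite (le_trans (ler_wpM2l (p_ge0 a) (cosh_fnormD s (Y a))))//.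
  rewrite mulrDr fdotZl (fdotC (Y a)) [X in _ + X <= _]mulrCA lerD2r.
  rewrite mulrCA ler_wpM2l ?(ltW (cosh_gt0 _))//.
  have -> : p a + p a * fnorm (Y a) ^+ 2 = p a * (1 + fnorm (Y a) ^+ 2) by ring.
  rewrite ler_wpM2l// lerBlDr.
  rewrite addrAC expR_le_quadratic ?fnorm_ge0//.
  by rewrite Y_bounded.
rewrite (le_trans (ler_sum _ (fun a _ => h a)))//.
rewrite big_split/= -!mulr_sumr -fdot_suml Y_centered fdot0l mulr0 addr0.
rewrite ler_wpM2l ?(ltW (cosh_gt0 _))// big_split/= p_sum1.
by rewrite (le_trans _ (expR_ge1Dx _))// lerD2l.
Qed.

(** The starting point [s] is arbitrary so that the induction can absorb the first draw into it. *)
Lemma mean_cosh_sum n s :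
  \sum_(j : {ffun 'I_n -> T})
     (\prod_i p (j i)) * cosh (fnorm (s + \sum_i Y (j i))) <=
  cosh (fnorm s) * expR v ^+ n.
Proof.
elim: n s => [|n IH] s.
  rewrite expr0 mulr1 (eq_bigr (fun j : {ffun 'I_0 -> T} =>
     (\prod_i p (j i)) * cosh (fnorm s))) => [|j _]; last first.
    by rewrite [X in s + X]big_ord0 addr0.
  by rewrite -mulr_suml sum_prod_ffun// mul1r.
rewrite sum_ffun_cons.
have h a : \sum_(j : {ffun 'I_n -> T}) (\prod_i p (ffun_cons a j i)) *
     cosh (fnorm (s + \sum_i Y (ffun_cons a j i))) <=
   p a * cosh (fnorm (s + Y a)) * expR v ^+ n.
  rewrite -mulrA (le_trans _ (ler_wpM2l (p_ge0 a) (IH _)))// mulr_sumr.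
  apply: ler_sum => j _.
  have -> : \sum_i Y (ffun_cons a j i) = Y a + \sum_i Y (j i).
    rewrite big_ord_recl ffun_cons0; congr (_ + _).
    by apply: eq_bigr => i _; rewrite ffun_consS.
  have -> : \prod_i p (ffun_cons a j i) = p a * \prod_i p (j i).
    rewrite big_ord_recl ffun_cons0; congr (_ * _).
    by apply: eq_bigr => i _; rewrite ffun_consS.
  by rewrite addrA -mulrA.
rewrite (le_trans (ler_sum _ (fun a _ => h a)))// -mulr_suml exprS mulrA.
by rewrite ler_wpM2r ?exprn_ge0 ?expR_ge0// mean_cosh_step.
Qed.

(** Markov's inequality for cosh of the norm; the factor 2 comes from [expR x / 2 <= cosh x]. *)
Lemma product_tail n t :
  \sum_(j : {ffun 'I_n -> T} | t < fnorm (\sum_i Y (j i))) \prod_i p (j i) <=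
  2 * expR (n%:R * v - t).
Proof.
have w0 (j : {ffun 'I_n -> T}) : 0 <= \prod_i p (j i) by exact: prodr_ge0.
rewrite expRD expRN mulrA ler_pdivlMr ?expR_gt0// mulr_suml.
have := mean_cosh_sum n 0.
have -> : fnorm (0 : 'M[R]_(m, k)) = 0 by rewrite /fnorm fdot0l sqrtr0.
rewrite cosh0 mul1r -expRM_natl => h.
have {}h := ler_wpM2l (ler0n R 2) h; apply: le_trans h.
rewrite big_mkcond/= mulr_sumr ler_sum// => j _; rewrite add0r.
case: ifPn => [tj|_]; last by rewrite mulr_ge0// mulr_ge0// ltW ?cosh_gt0.
rewrite mulrCA ler_wpM2l// mulrC -ler_pdivrMr//.
by rewrite (le_trans _ (cosh_geE _))// ler_pM2r ?invr_gt0// ler_expR ltW.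
Qed.

End Tail.
End ProductWeights.

(** * From product weights to probabilities of independent draws *)

Section Law.
Context {R : realType} disp (Omega : measurableType disp) (P : probability Omega R).
Context {T : finType} {U : Type} (val : T -> U) {n : nat} (X : 'I_n -> Omega -> U).
Variable p : T -> R.
Hypothesis val_inj : injective val.
Hypothesis X_val : forall i w, exists a, X i w = val a.
Hypothesis X_measurable : forall i a, measurable (X i @^-1` [set val a]).
Hypothesis X_law : forall i a, P (X i @^-1` [set val a]) = (p a)%:E.
Hypothesis X_indep : mutually_independent P X.

(** The event is a finite disjoint union of cylinders, one for each sequence of values, and
    independence factors the probability of each. *)
Lemma independent_law (Q : pred {ffun 'I_n -> T}) :
  P [set w | exists2 j, Q j & forall i, X i w = val (j i)] =
  (\sum_(j | Q j) \prod_i p (j i))%:E.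
Proof.
pose C (j : {ffun 'I_n -> T}) := \bigcap_(i in [set: 'I_n]) X i @^-1` [set val (j i)].
have -> : [set w | exists2 j, Q j & forall i, X i w = val (j i)] =
    \bigcup_(j in [set j | Q j]) C j.
  apply/seteqP; split => [w [j Qj Xj]|w [j Qj Xj]].
    by exists j => // i _; exact: Xj.
  by exists j => // i; exact: Xj.
rewrite measure_fin_bigcup; last 3 first.
- exact: finite_finset.
- move=> j j' _ _ [w [wj wj']]; apply/ffunP => i; apply: val_inj.
  by rewrite -(wj i)// -(wj' i).
- move=> j _; apply: fin_bigcap_measurable => // i _; exact: X_measurable.
rewrite (fsbigE (enum Q)) ?enum_uniq//; last 2 first.
+ by move=> j; rewrite /= mem_enum.
+ by move=> j Qj; rewrite mem_enum => /negP.
rewrite -sumEFin big_enum_cond/=; apply: eq_big => [j|j _].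
  by apply/andb_idr => Qj; rewrite inE.
rewrite X_indep (eq_bigr (fun i => (p (j i))%:E)) => [|i _]; last exact: X_law.
by rewrite prodEFin.
Qed.

Hypothesis p_ge0 : forall a, 0 <= p a.
Hypothesis p_sum1 : \sum_a p a = 1.

(** Almost all the content is that an event depending only on the drawn values is a finite union of
    cylinders, whatever [G] is; its probability is then a sum of product weights. *)
Lemma independent_lower_bound (G : set ('I_n -> U)) (B : pred {ffun 'I_n -> T}) :
  (forall j : {ffun 'I_n -> T}, ~~ B j -> G (val \o j)) ->
  ((1 - \sum_(j | B j) \prod_i p (j i))%:E <= P [set w | G (X^~ w)])%E.
Proof.
move=> BG.
pose Q (j : {ffun 'I_n -> T}) := `[< G (val \o j) >].
have -> : [set w | G (X^~ w)] = [set w | exists2 j, Q j & forall i, X i w = val (j i)].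
  apply/seteqP; split => w /=.
    move=> Gw.
    have [f fE] := fin_all_exists (X_val^~ w).
    exists [ffun i => f i] => [|i]; last by rewrite ffunE.
    apply/asboolP; rewrite (_ : _ \o _ = X^~ w)//.
    by apply/funext => i /=; rewrite ffunE fE.
  move=> [j /asboolP Gj Xj]; rewrite (_ : X^~ w = val \o j)//.
  by apply/funext => i; rewrite Xj.
rewrite independent_law lee_fin lerBlDr -[leLHS](sum_prod_ffun n p_sum1).
rewrite (bigID B)/= addrC lerD2r [leLHS]big_mkcond [leRHS]big_mkcond/=.
apply: ler_sum => j _; case: ifPn => [/BG Gj|_]; first by rewrite /Q asboolT.
by case: ifP => // _; exact: prodr_ge0.
Qed.

End Law.

(** * The variance matrix and its intrinsic dimensions *)

Section Variance.
Context {R : realType} {d K : nat}.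
Variables (x : 'I_K -> 'cV[R]_d) (mu : 'I_K -> R).
Hypothesis mu_simplex : simplex mu.

Let mu_ge0 k : 0 <= mu k.
Proof. by case: mu_simplex => /(_ k)/andP[]. Qed.

Let mu_sum1 : \sum_k mu k = 1.
Proof. by case: mu_simplex. Qed.

Let M := info_mx x mu.
Let B k := outer x k - M.

Lemma outer_sym k : (outer x k)^T = outer x k.
Proof. by rewrite /outer trmx_mul trmxK. Qed.

Lemma info_mx_sym : (info_mx x mu)^T = info_mx x mu.
Proof.
by rewrite raddf_sum; apply: eq_bigr => k _ /=; rewrite linearZ/= outer_sym.
Qed.

Let B_sym k : (B k)^T = B k.
Proof. by rewrite /B linearB/= outer_sym info_mx_sym. Qed.

Lemma outer_centered : \sum_k mu k *: (outer x k - info_mx x mu) = 0.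
Proof.
under eq_bigr do rewrite scalerBr.
by rewrite sumrB -scaler_suml mu_sum1 scale1r subrr.
Qed.

Lemma variance_mxE : variance_mx x mu =
  \sum_k mu k *: ((outer x k - info_mx x mu) *m (outer x k - info_mx x mu)).
Proof.
rewrite -/M /variance_mx /second_moment.
(* The square is expanded so that the last product contains [B k] linearly; its mean vanishes by
   centring. *)
transitivity (\sum_k (mu k *: (outer x k *m outer x k) -
  (mu k *: outer x k) *m M - M *m (mu k *: B k))); last first.
  apply: eq_bigr => k _; rewrite -scalemxAl -scalemxAr -!scalerBr; congr (_ *: _).
  by rewrite /B mulmxBl !mulmxBr opprB addrA.
rewrite !sumrB -mulmx_suml -mulmx_sumr outer_centered mulmx0 subr0//.
Qed.

Lemma variance_mx_psd : psd (variance_mx x mu).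
Proof.
rewrite variance_mxE; split.
  rewrite raddf_sum; apply: eq_bigr => k _ /=.
  by rewrite linearZ/= trmx_mul -/M -/(B k) B_sym.
move=> v; rewrite mulmx_suml fdot_suml; apply: sumr_ge0 => k _.
rewrite -scalemxAl fdotZl mulr_ge0// -mulmxA fdot_mulmxl -/M -/(B k) B_sym.
exact: fdot_ge0.
Qed.

Lemma trace_variance_mx : \tr (variance_mx x mu) =
  \sum_k mu k * fnorm (outer x k - info_mx x mu) ^+ 2.
Proof.
rewrite variance_mxE raddf_sum; apply: eq_bigr => k _ /=.
by rewrite mxtraceZ sqr_fnorm /fdot -/M -/(B k) B_sym.
Qed.

Lemma fdot_outer j k : fdot (outer x j) (outer x k) = fdot (x j) (x k) ^+ 2.
Proof.
rewrite {1}/outer fdot_mulmxl fdotC /outer mulmxA.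
rewrite (_ : (x j)^T *m x k = (fdot (x j) (x k))%:M); last first.
  by rewrite fdot_colE -mx11_scalar.
by rewrite mul_scalar_mx fdotZl /fdot trmxK mxtrace_mulC expr2.
Qed.

Lemma sqr_fnorm_le_max k : fnorm (x k) ^+ 2 <= max_sqnorm x.
Proof. by rewrite -l2normE; exact: (le_bigmax _ (fun k => l2norm (x k) ^+ 2)). Qed.

(* The off-diagonal terms of tr (M^2) are nonnegative and are dropped. *)
Lemma trace_variance_le : \tr (variance_mx x mu) <= sigma2 x mu.
Proof.
have tM : \sum_k mu k ^+ 2 * fdot (x k) (x k) ^+ 2 <= \tr (M *m M).
  have -> : \tr (M *m M) = fdot M M by rewrite /fdot info_mx_sym.
  rewrite {1}/M /info_mx fdot_suml; apply: ler_sum => k _.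
  rewrite fdotC fdotZr /M /info_mx fdot_suml (bigD1 k)//= fdotZl fdot_outer.
  rewrite mulrDr mulrA -expr2 lerDl mulr_ge0// sumr_ge0// => j _.
  by rewrite fdotZl fdot_outer mulr_ge0 ?sqr_ge0.
have tS : \tr (second_moment x mu) = \sum_k mu k * fdot (x k) (x k) ^+ 2.
  rewrite raddf_sum; apply: eq_bigr => k _ /=.
  by rewrite mxtraceZ -fdot_outer /fdot outer_sym.
rewrite /variance_mx raddfB/= tS -/M lerBlDr.
rewrite (le_trans _ (lerD (lexx _) tM))// /sigma2 mulr_sumr -big_split ler_sum//= => k _.
rewrite -lerBlDr.
have -> : mu k * fdot (x k) (x k) ^+ 2 - mu k ^+ 2 * fdot (x k) (x k) ^+ 2 =
  fdot (x k) (x k) ^+ 2 * (mu k * (1 - mu k)) by ring.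
have mk1 : mu k <= 1 by case: mu_simplex => /(_ k)/andP[].
rewrite ler_wpM2r ?mulr_ge0 ?subr_ge0// -sqr_fnorm.
by rewrite lerXn2r ?nnegrE ?sqr_ge0 ?(le_trans (sqr_ge0 _) (sqr_fnorm_le_max k))
  ?sqr_fnorm_le_max.
Qed.

End Variance.

(** * Extreme eigenvalues and bounds on the intrinsic dimensions *)

Section Dimensions.
Context {R : realType} {d : nat} (V : 'M[R]_d).
Hypothesis V_psd : psd V.
Hypothesis d_gt0 : (0 < d)%N.

Lemma psd_eigenvalue_ge0 a : eigenvalue V a -> 0 <= a.
Proof.
move=> /eigenvalueP[v vV v0]; have := V_psd.2 v^T.
rewrite -{1}V_psd.1 -trmx_mul vV linearZ/= fdotZl.
have vv : 0 < fdot v^T v^T.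
  rewrite lt_neqAle fdot_ge0 andbT eq_sym; apply: contra v0 => /eqP/fdot_eq0.
  by move/(congr1 trmx); rewrite trmxK trmx0 => ->.
by rewrite pmulr_lge0.
Qed.

(** The Rayleigh quotients of [V]. Their infimum [m] turns out to be an eigenvalue, which makes the
    set defining [lambda_min] nonempty and gives [lambda_min V <= m]. *)
Let unit_vectors := [set fdot (V *m v) v | v in [set v : 'cV[R]_d | fdot v v = 1]].
Let m := inf unit_vectors.

Let unit_lb : has_lbound unit_vectors.
Proof. by exists 0 => _ [v _ <-]; exact: V_psd.2. Qed.

Let unit_neq0 : unit_vectors !=set0.
Proof.
pose e : 'cV[R]_d := delta_mx (Ordinal d_gt0) 0.
exists (fdot (V *m e) e), e => //=.
by rewrite -[X in fdot X _]mul1mx fdot_delta mxE eqxx.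
Qed.

Let sub_scalar_psd a : a <= m -> psd (V - a%:M).
Proof.
move=> am; split; first by rewrite linearB/= V_psd.1 tr_scalar_mx.
move=> v; rewrite mulmxBl mul_scalar_mx fdotDl fdotNl fdotZl subr_ge0.
have := fdot_ge0 v; rewrite le_eqVlt => /predU1P[v0|v0].
  by rewrite -v0 mulr0 V_psd.2.
rewrite -ler_pdivlMr// (le_trans am)//; apply: (ge_inf unit_lb).
exists ((fnorm v)^-1 *: v) => /=.
  by rewrite fdotZl fdotZr mulrA -expr2 exprVn sqr_fnorm mulVf ?gt_eqF.
by rewrite -scalemxAr fdotZl fdotZr mulrA -expr2 exprVn sqr_fnorm mulrC.
Qed.

(** If [V - m%:M] were invertible it would be coercive, and every Rayleigh quotient would exceed [m]
    by a fixed positive amount. *)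
Let eigenvalue_m : eigenvalue V m.
Proof.
rewrite /eigenvalue /eigenspace kermx_eq0 row_free_unit; apply/negP => Vu.
have [c c0 cV] := psd_unit_coercive (sub_scalar_psd (lexx m)) Vu.
have : m + c <= m.
  apply: (lb_le_inf unit_neq0) => _ [v /= v1 <-].
  have := cV v; rewrite v1 mulr1 mulmxBl mul_scalar_mx fdotDl fdotNl fdotZl v1.
  by rewrite mulr1 lerBrDr addrC.
by rewrite gerDl leNgt c0.
Qed.

Lemma psd_sub_lambda_min : psd (V - (lambda_min V)%:M).
Proof.
apply: sub_scalar_psd; apply: ge_inf => //.
by exists 0 => a /=; exact: psd_eigenvalue_ge0.
Qed.

Lemma lambda_min_ge0 : 0 <= lambda_min V.
Proof.
apply: lb_le_inf; first by exists m.
by move=> a /=; exact: psd_eigenvalue_ge0.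
Qed.

Lemma psd_spectral_norm_sub : psd ((spectral_norm V)%:M - V).
Proof.
split; first by rewrite linearB/= V_psd.1 tr_scalar_mx.
move=> v; rewrite mulmxBl mul_scalar_mx fdotDl fdotNl fdotZl subr_ge0.
rewrite (le_trans (ler_norm _))// (le_trans (ler_fdot_fnorm _ _))//.
rewrite (le_trans (ler_wpM2r (fnorm_ge0 _) (fnorm_mulmx_spectral _ _)))//.
by rewrite -mulrA -expr2 sqr_fnorm.
Qed.

(** After the shift by [lambda_min V] the matrix is positive semidefinite, so its trace dominates
    its Frobenius norm. This is what puts the upper dimension above 1. *)
Lemma spectral_norm_le_trace :
  spectral_norm V <= lambda_min V + \tr (V - (lambda_min V)%:M).
Proof.
have Q := psd_sub_lambda_min; have l0 := lambda_min_ge0.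
apply: spectral_norm_le => [v|]; last by rewrite addr_ge0 ?psd_trace_ge0.
rewrite -{1}[V](subrK (lambda_min V)%:M) mulmxDl mul_scalar_mx addrC.
rewrite (le_trans (ler_fnormD _ _))// mulrDl lerD//.
  by rewrite fnormZ ger0_norm.
rewrite (le_trans (ler_fnormM _ _))// ler_wpM2r ?fnorm_ge0//.
exact: psd_fnorm_le_trace.
Qed.

Hypothesis V_nonscalar : ~~ is_scalar_mx V.

Lemma trace_spectral_norm_sub_gt0 : 0 < \tr ((spectral_norm V)%:M - V).
Proof.
rewrite lt_neqAle psd_trace_ge0 ?andbT; last exact: psd_spectral_norm_sub.
apply: contra V_nonscalar; rewrite eq_sym => /eqP.
move=> /(psd_trace_eq0 psd_spectral_norm_sub)/eqP.
by rewrite subr_eq0 => /eqP <-; exact: scalar_mx_is_scalar.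
Qed.

(** The trace of [V] is at least [d] times the left-hand side and strictly below [d] times the
    right-hand side. *)
Lemma lambda_min_lt_spectral_norm : lambda_min V < spectral_norm V.
Proof.
have := psd_trace_ge0 psd_sub_lambda_min.
have := trace_spectral_norm_sub_gt0.
rewrite !raddfB/= !mxtrace_scalar subr_gt0 subr_ge0 => h1 h2.
by have := le_lt_trans h2 h1; rewrite ltr_pMn2r.
Qed.

Lemma lower_dim_gt0 : 0 < lower_dim V.
Proof.
rewrite divr_gt0 ?subr_gt0 ?lambda_min_lt_spectral_norm//.
exact: trace_spectral_norm_sub_gt0.
Qed.

Lemma upper_dim_ge1 : 1 <= upper_dim V.
Proof.
rewrite ler_pdivlMr ?subr_gt0 ?lambda_min_lt_spectral_norm// mul1r lerBlDl.
exact: spectral_norm_le_trace.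
Qed.

Lemma upper_lower_dim : upper_dim V + lower_dim V = d%:R.
Proof.
have := lambda_min_lt_spectral_norm; rewrite -subr_gt0 => h.
rewrite /upper_dim /lower_dim -mulrDl !raddfB/= !mxtrace_scalar.
apply: (canLR (mulfK _)); first by rewrite gt_eqF.
by rewrite -(mulr_natl (lambda_min V)) -(mulr_natl (spectral_norm V)); ring.
Qed.

Lemma cond_number_inv_lt1 : (cond_number V)^-1 < 1.
Proof.
rewrite /cond_number invf_div ltr_pdivrMr ?mul1r ?lambda_min_lt_spectral_norm//.
by rewrite (le_lt_trans lambda_min_ge0)// lambda_min_lt_spectral_norm.
Qed.

End Dimensions.

(** * Random designs *)

Section Draws.
Context {R : realType} {d K : nat}.
Variables (x : 'I_K -> 'cV[R]_d) (mu : 'I_K -> R).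
Hypothesis mu_simplex : simplex mu.

Let T : finType := seq_sub (codom (outer x)).

(* The indices behind the draws need not be independent when several of them
   give the same matrix, so the law is carried by the distinct matrices. *)
Let weight (a : T) : R := \sum_(k | outer x k == ssval a) mu k.

Let val_of k : T := SeqSub (codom_f (outer x) k).

(** Moves averages between distinct matrices and indices; module-valued so as to cover matrix means
    and, with [R^o], scalar ones. *)
Let weight_sum (W : lmodType R) (f : 'M[R]_d -> W) :
  \sum_a weight a *: f (ssval a) = \sum_k mu k *: f (outer x k).
Proof.
rewrite [RHS](partition_big val_of xpredT)//=; apply: eq_bigr => a _.
rewrite scaler_suml; apply: eq_big => [k|k /eqP <- //].
by rewrite -val_eqE.
Qed.

Let weight_ge0 a : 0 <= weight a.
Proof. by apply: sumr_ge0 => k _; case: mu_simplex => /(_ k)/andP[]. Qed.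

Let weight_sum1 : \sum_a weight a = 1.
Proof.
have := weight_sum (fun=> 1 : R^o).
under eq_bigr do rewrite /GRing.scale/= mulr1.
by under [RHS]eq_bigr do rewrite /GRing.scale/= mulr1; move=> ->; case: mu_simplex.
Qed.

Context disp (Omega : measurableType disp) (P : probability Omega R).

Let draw_event (Z : Omega -> 'M[R]_d) (a : T) : drawn_from x mu P Z ->
  measurable (Z @^-1` [set ssval a]) /\ P (Z @^-1` [set ssval a]) = (weight a)%:E.
Proof.
move=> [idx [idxm idxP ZE]].
pose D := [pred k | outer x k == ssval a].
have -> : Z @^-1` [set ssval a] = \bigcup_(k in [set k | D k]) (idx @^-1` [set k]).
  apply/seteqP; split => [w Zw|w [k /eqP Dk /= wk]].
    by exists (idx w) => //=; rewrite -ZE; apply/eqP.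
  by rewrite /preimage/= ZE wk.
split; first by apply: fin_bigcup_measurable => //; exact: finite_finset.
rewrite measure_fin_bigcup//; last 2 first.
- exact: finite_finset.
- by move=> k k' _ _ [w [/= <- <-]].
rewrite (fsbigE (enum D)) ?enum_uniq//; last 2 first.
+ by move=> k; rewrite /= mem_enum.
+ by move=> k Dk; rewrite mem_enum => /negP.
rewrite -sumEFin big_enum_cond/=; apply: eq_big => [k|k _]; last exact: idxP.
by apply/andb_idr => Dk; rewrite inE.
Qed.

Lemma draws_lower_bound n (X : 'I_n -> Omega -> 'M[R]_d) (lam t v : R)
    (G : set ('I_n -> 'M[R]_d)) :
  iid_draws x mu P X -> 0 <= lam ->
  (forall k, lam * fnorm (outer x k - info_mx x mu) <= 3^-1) ->
  \tr (variance_mx x mu) <= v ->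
  (forall A : 'I_n -> 'M[R]_d,
    fnorm (\sum_i A i - n%:R *: info_mx x mu) <= t -> G A) ->
  ((1 - 2 * expR (n%:R * (lam ^+ 2 * v) - lam * t))%:E <=
   P [set w | G (X^~ w)])%E.
Proof.
move=> [Xd Xi]; rewrite le_eqVlt => /predU1P[<- _ _ _|lam0 Ylam vE tG].
  (* For [lam = 0] the lower bound is -1. *)
  rewrite expr0n/= !mul0r mulr0 subrr expR0.
  apply: (@le_trans _ _ (0%:E)%E); last exact: measure_ge0.
  by rewrite lee_fin; lra.
set M := info_mx x mu in Ylam tG *.
(* Scaling by [lam] brings the centred draws below the norm threshold 1/3 of the tail bound. *)
pose Y (a : T) := lam *: (ssval a - M).
have Yc : \sum_a weight a *: Y a = 0.
  rewrite (weight_sum (fun A => lam *: (A - M))).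
  under eq_bigr do rewrite scalerA mulrC -scalerA.
  by rewrite -scaler_sumr outer_centered// scaler0.
have Yb a : fnorm (Y a) <= 3^-1.
  have /codomP[k kE] := ssvalP a.
  by rewrite /Y kE fnormZ gtr0_norm.
have Yv : \sum_a weight a * fnorm (Y a) ^+ 2 <= lam ^+ 2 * v.
  have := weight_sum (fun A => fnorm (lam *: (A - M)) ^+ 2 : R^o).
  rewrite /GRing.scale/= => ->.
  under eq_bigr do rewrite fnormZ gtr0_norm// exprMn mulrCA.
  by rewrite -mulr_sumr ler_wpM2l ?sqr_ge0// -trace_variance_mx.
pose B := [pred j : {ffun 'I_n -> T} | lam * t < fnorm (\sum_i Y (j i))].
have BG (j : {ffun 'I_n -> T}) : ~~ B j -> G (@ssval _ _ \o j).
  rewrite /= -leNgt -scaler_sumr fnormZ gtr0_norm// ler_pM2l// => h; apply: tG.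
  by move: h; rewrite sumrB sumr_const card_ord scaler_nat.
have XT i w : exists a : T, X i w = ssval a.
  by have [idx [_ _ ->]] := Xd i; exists (val_of (idx w)).
have Xm i a := (draw_event a (Xd i)).1; have Xp i a := (draw_event a (Xd i)).2.
apply: le_trans (independent_lower_bound val_inj XT Xm Xp Xi weight_ge0 weight_sum1 BG).
by rewrite lee_fin lerD2l lerN2 product_tail.
Qed.

End Draws.

(** * Perturbation of the inverse *)

Section Perturbation.
Context {R : realType} {d : nat}.

Lemma unitmx_col_kernel (A : 'M[R]_d) :
  (forall v : 'cV[R]_d, A *m v = 0 -> v = 0) -> A \in unitmx.
Proof.
move=> A0; rewrite -unitmx_tr -row_free_unit -kermx_eq0; apply/rowV0P => v.
move=> /sub_kermxP vA; apply: trmx_inj; rewrite trmx0; apply: A0.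
by apply: trmx_inj; rewrite trmx_mul trmxK vA trmx0.
Qed.

Lemma inverse_perturbation (M D : 'M[R]_d) (eps : R) :
  let b := spectral_norm (invmx M) in
  M \in unitmx -> fnorm D <= eps -> b * eps <= 2^-1 ->
  M + D \in unitmx /\ forall u : 'cV[R]_d,
    (u^T *m invmx (M + D) *m u) 0 0 <= (u^T *m invmx M *m u) 0 0 +
      fnorm u ^+ 2 * (b ^+ 2 * eps + 2 * b ^+ 3 * eps ^+ 2).
Proof.
move=> b Mu De be.
have b0 : 0 <= b := spectral_norm_ge0 _.
have e0 : 0 <= eps := le_trans (fnorm_ge0 D) De.
have MD (v : 'cV[R]_d) : fnorm (invmx M *m (D *m v)) <= b * eps * fnorm v.
  rewrite (le_trans (fnorm_mulmx_spectral _ _))// -mulrA ler_wpM2l//.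
  by rewrite (le_trans (ler_fnormM _ _))// ler_wpM2r ?fnorm_ge0.
(* This resolvent identity gives injectivity of [M + D], the bound on [y] and the final
   expansion. *)
have yE (v : 'cV[R]_d) : v = invmx M *m ((M + D) *m v) - invmx M *m (D *m v).
  by rewrite mulmxDl mulmxDr mulKmx// addrK.
have Tu : M + D \in unitmx.
  apply: unitmx_col_kernel => v v0; apply: fnorm_eq0.
  have h : fnorm v <= b * eps * fnorm v by rewrite {1}(yE v) v0 mulmx0 add0r fnormN MD.
  apply/eqP; rewrite eq_le fnorm_ge0 andbT.
  have := ler_wpM2r (fnorm_ge0 v) be. lra.
split=> // u; set y := invmx (M + D) *m u.
have Ty : (M + D) *m y = u by rewrite mulKVmx.
have y_le : fnorm y <= b * fnorm u * (1 + 2 * (b * eps)).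
  have h : fnorm y * (1 - b * eps) <= b * fnorm u.
    have : fnorm y <= b * fnorm u + b * eps * fnorm y.
      rewrite {1}(yE y) Ty (le_trans (ler_fnormB _ _))// lerD//.
      exact: fnorm_mulmx_spectral.
    lra.
  have be0 : 0 <= b * eps by rewrite mulr_ge0.
  (* With [t = b * eps] in [0, 1/2], [(1 - t) * (1 + 2 * t)] is at least 1. *)
  apply: (@le_trans _ _ (fnorm y * (1 - b * eps) * (1 + 2 * (b * eps)))); last first.
    by rewrite ler_wpM2r// addr_ge0// mulr_ge0.
  rewrite -mulrA ler_peMr ?fnorm_ge0//.
  have := mulr_ge0 be0 (_ : 0 <= 1 - 2 * (b * eps)); lra.
rewrite -!mulmxA -!fdot_colE -/y {1}(yE y) Ty fdotDr fdotNr lerD2l.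
rewrite (le_trans (ler_norm _))// normrN (le_trans (ler_fdot_fnorm _ _))//.
rewrite (le_trans (ler_wpM2l (fnorm_ge0 _) (MD _)))//.
rewrite mulrA (le_trans (ler_wpM2l _ y_le)) ?mulr_ge0 ?fnorm_ge0//.
by rewrite le_eqVlt; apply/orP; left; apply/eqP; ring.
Qed.

End Perturbation.

(** * From additive to relative error in the G-criterion *)

Section GOptimal.
Context {R : realType} {d K : nat}.
Variables (x : 'I_K -> 'cV[R]_d) (mu : 'I_K -> R).
Hypothesis mu_simplex : simplex mu.
Let M := info_mx x mu.
Hypothesis M_unit : M \in unitmx.

Lemma le_fG (A : 'M[R]_d) k : ((x k)^T *m A *m x k) 0 0 <= fG x A.
Proof. exact: (le_bigmax _ (fun k => ((x k)^T *m A *m x k) 0 0)). Qed.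

(* The average of x_k^T M^-1 x_k under mu is tr (M^-1 M) = d. *)
Lemma fG_star_ge n : (0 < n)%N -> d%:R / n%:R <= fG_star x mu n.
Proof.
move=> n0; have n0' : n%:R != 0 :> R by rewrite pnatr_eq0 -lt0n.
have nMu : n%:R *: M \in unitmx by rewrite unitmxZ// unitfE.
have -> : d%:R / n%:R = \sum_k mu k * ((x k)^T *m invmx (n%:R *: M) *m x k) 0 0.
  transitivity (\tr (invmx (n%:R *: M) *m M)).
    by rewrite invmxZ// -scalemxAl mulVmx// mxtraceZ mxtrace1 mulrC.
  rewrite {2}/M /info_mx mulmx_sumr raddf_sum; apply: eq_bigr => k _ /=.
  by rewrite -scalemxAr mxtraceZ /outer mulmxA mxtrace_mulC mulmxA trace_mx11.
have [mu01 mu1] := mu_simplex.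
have -> : fG_star x mu n = \sum_k mu k * fG_star x mu n.
  by rewrite -mulr_suml mu1 mul1r.
by apply: ler_sum => k _; have /andP[mk _] := mu01 k; rewrite (ler_wpM2l mk)// le_fG.
Qed.

Lemma fG_inv_le n (S : 'M[R]_d) (eps r : R) :
  let b := spectral_norm (invmx M) in
  let L := max_sqnorm x in
  (0 < n)%N -> (0 < d)%N -> fnorm (S - n%:R *: M) <= n%:R * eps ->
  b * eps <= 2^-1 -> 2 * L * b ^+ 3 * eps ^+ 2 <= r * d%:R ->
  (fG_inv x S <= ((1 + L / d%:R * b ^+ 2 * eps + r) * fG_star x mu n)%:E)%E.
Proof.
move=> b L n0 d0 Se be re.
have n0' : 0 < n%:R :> R by rewrite ltr0n.
have d0' : 0 < d%:R :> R by rewrite ltr0n.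
have nu : n%:R != 0 :> R by rewrite gt_eqF.
pose D := n%:R^-1 *: (S - n%:R *: M).
have SE : S = n%:R *: (M + D).
  by rewrite scalerDr scalerA mulfV// scale1r addrC subrK.
have De : fnorm D <= eps.
  by rewrite /D fnormZ ger0_norm ?invr_ge0 ?(ltW n0')// ler_pdivrMl.
have [Tu Tle] := inverse_perturbation M_unit De be.
have Su : S \in unitmx by rewrite SE unitmxZ// unitfE.
have b0 : 0 <= b := spectral_norm_ge0 _.
have e0 : 0 <= eps := le_trans (fnorm_ge0 D) De.
have L0 : 0 <= L by exact: bigmax_ge_id.
have r0 : 0 <= r.
  by rewrite -(pmulr_lge0 _ d0') (le_trans _ re)// !mulr_ge0// ?exprn_ge0// sqr_ge0.
have f0 := fG_star_ge n0; set f := fG_star x mu n in f0 *.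
have f0' : 0 <= f by rewrite (le_trans _ f0)// divr_ge0// ler0n.
have h : L * (b ^+ 2 * eps + 2 * b ^+ 3 * eps ^+ 2) / n%:R <=
    (L / d%:R * b ^+ 2 * eps + r) * f.
  apply: (@le_trans _ _ ((L / d%:R * b ^+ 2 * eps + r) * (d%:R / n%:R))).
    rewrite [leRHS]mulrA ler_wpM2r ?invr_ge0 ?(ltW n0')//.
    have -> : (L / d%:R * b ^+ 2 * eps + r) * d%:R = L * b ^+ 2 * eps + r * d%:R.
      by field; rewrite gt_eqF.
    lra.
  by rewrite ler_wpM2l// addr_ge0// !mulr_ge0// ?invr_ge0 ?(ltW d0')// sqr_ge0.
rewrite /fG_inv Su lee_fin -addrA mulrDl mul1r.
(* The maximum starts at 0, so the bound must itself be shown nonnegative. *)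
apply: bigmax_le => [|k _].
  rewrite addr_ge0// (le_trans _ h)// divr_ge0 ?(ltW n0')// mulr_ge0// addr_ge0//.
    by rewrite mulr_ge0// sqr_ge0.
  by rewrite !mulr_ge0// ?exprn_ge0// sqr_ge0.
rewrite SE invmxZ -?SE// -scalemxAr -scalemxAl mxE.
apply: (@le_trans _ _ (n%:R^-1 * (((x k)^T *m invmx M *m x k) 0 0 +
    L * (b ^+ 2 * eps + 2 * b ^+ 3 * eps ^+ 2)))).
  rewrite ler_wpM2l ?invr_ge0 ?(ltW n0')// (le_trans (Tle (x k)))// lerD2l.
  rewrite ler_wpM2r ?sqr_fnorm_le_max// addr_ge0//.
    by rewrite mulr_ge0// sqr_ge0.
  by rewrite !mulr_ge0// ?exprn_ge0// sqr_ge0.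
rewrite mulrDr lerD//; last by rewrite mulrC.
have := le_fG (invmx (n%:R *: M)) k; rewrite -/(fG_star x mu n) -/f.
by rewrite invmxZ ?unitmxZ ?unitfE// -scalemxAr -scalemxAl mxE.
Qed.

End GOptimal.

(** * Remainder sequence, sample-size threshold and conclusion *)

Lemma littleo_invn_invsqrt (R : realType) (C : R) : 0 <= C ->
  (fun n => C / n%:R) =o_\oo (fun n : nat => (Num.sqrt n%:R)^-1 : R).
Proof.
move=> C0; apply/eqoP => e e0; near=> n.
have n0 : 0 < n%:R :> R by rewrite ltr0n; near: n; exact: nbhs_infty_gt.
have nC : (C / e) ^+ 2 <= n%:R by near: n; exact: nbhs_infty_ger.
have s0 : 0 < Num.sqrt n%:R :> R by rewrite sqrtr_gt0.
have nE : n%:R = Num.sqrt n%:R ^+ 2 :> R by rewrite sqr_sqrtr// ltW.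
rewrite ger0_norm ?divr_ge0 ?(ltW n0)// ger0_norm ?invr_ge0 ?(ltW s0)//.
rewrite ler_pdivrMr//.
have -> : e / Num.sqrt n%:R * n%:R = e * Num.sqrt n%:R.
  by rewrite [X in _ * X = _]nE; field; rewrite gt_eqF.
rewrite mulrC -ler_pdivrMr// -(ler_pXn2r (isT : (0 < 2)%N)) ?nnegrE ?(ltW s0)//.
  by rewrite -nE.
by rewrite divr_ge0// ltW.
Unshelve. all: by end_near. Qed.
Theorem theorem3p2 (R : realType) (d K : nat) (x : 'I_K -> 'cV[R]_d)
    (mu : 'I_K -> R) (delta : R) :
  spanning x ->
  G_optimal x mu ->
  ~~ is_scalar_mx (variance_mx x mu) ->
  0 < delta <= 1 ->
  let M := info_mx x mu in
  let V := variance_mx x mu in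
  let L := max_sqnorm x in
  let s2 := sigma2 x mu in
  let dt := dtilde x mu in
  (forall n : nat, (0 < n)%N -> dt n < d%:R) /\
  exists r : nat -> R,
    r =o_\oo (fun n : nat => (Num.sqrt n%:R)^-1 : R) /\
    exists N : nat, forall n : nat, (N <= n)%N ->
      4 * L ^+ 2 / (9 * spectral_norm V) * ln (dt n / delta) <= n%:R ->
      forall (disp : measure_display) (Omega : measurableType disp)
        (P : probability Omega R) (X : 'I_n -> Omega -> 'M[R]_d),
        iid_draws x mu P X ->
        ((1 - 2 * delta)%:E <=
         P [set w | fG_inv x (\sum_(i < n) X i w)
                    <= ((1 + L / d%:R * spectral_norm (invmx M) ^+ 2 *
                             Num.sqrt (4 * s2 / n%:R * ln (dt n / delta))
                           + r n) * fG_star x mu n)%:E])%E.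
Proof.
move=> _ [mu_simplex M_unit _] V_nonscalar /andP[delta0 delta1] M V L s2 dt.
have V_psd : psd V := variance_mx_psd x mu_simplex.
(* In dimension 0 every matrix counts as scalar. *)
have d_gt0 : (0 < d)%N.
  rewrite lt0n; apply: contra V_nonscalar => /eqP d0; rewrite /is_scalar_mx.
  by case: insubP => // i _ _; have := leq_trans (ltn_ord i) (eq_leq d0).
have d0 : 0 < d%:R :> R by rewrite ltr0n.
have dim := upper_lower_dim V_psd d_gt0 V_nonscalar.
have low0 := lower_dim_gt0 V_psd d_gt0 V_nonscalar.
have up1 := upper_dim_ge1 V_psd d_gt0 V_nonscalar.
have kappa1 := cond_number_inv_lt1 V_psd d_gt0 V_nonscalar.
have dt_lt n : (0 < n)%N -> dt n < d%:R.
  move=> n0; rewrite -dim ltrD2l gtr_pMr// expR_lt1 oppr_lt0.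
  by rewrite divr_gt0// mulr_gt0 ?ltr0n ?subr_gt0.
have dt1 n : 1 <= dt n.
  by rewrite (le_trans up1)// lerDl mulr_ge0 ?expR_ge0// ltW.
split=> //.
have trV : \tr V <= s2 := trace_variance_le x mu_simplex.
have s20 : 0 < s2.
  rewrite ltNge; apply: contra V_nonscalar => s2_le0.
  have trV0 : \tr V = 0.
    by apply/eqP; rewrite eq_le psd_trace_ge0// andbT (le_trans trV).
  by rewrite -/V (psd_trace_eq0 V_psd trV0) mx0_is_scalar.
clearbody s2.
pose ell n := ln (dt n / delta).
(* Since [dt n] stays below [d], this bounds all the logarithms at once and lets the remainder
   constant and the threshold be independent of [n]. *)
pose ellmax := ln (d%:R / delta).
have ell0 n : 0 <= ell n.
  by rewrite ln_ge0// ler_pdivlMr// mul1r (le_trans delta1).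
have ell_le n : (0 < n)%N -> ell n <= ellmax.
  move=> n0; rewrite ler_ln ?posrE ?divr_gt0// ?(lt_le_trans ltr01)//.
  by rewrite ler_pM2r ?invr_gt0// ltW// dt_lt.
have ellmax0 : 0 <= ellmax := le_trans (ell0 1%N) (ell_le 1%N isT).
set b := spectral_norm (invmx M).
have b0 : 0 <= b := spectral_norm_ge0 _.
have L0 : 0 <= L by exact: bigmax_ge_id.
pose C := \sum_k fnorm (outer x k - M).
have C0 : 0 <= C by apply: sumr_ge0 => k _; exact: fnorm_ge0.
(* Largest deviation allowed: the first summand forces [b * eps <= 1/2], the second keeps the scaled
   draws below 1/3, and the 1 makes the inverted quantity positive. *)
pose e0 := (2 * b + 3 * C / (2 * s2) + 1)^-1.
have e0_den : 0 < 2 * b + 3 * C / (2 * s2) + 1.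
  by rewrite ltr_wpDl// addr_ge0// ?divr_ge0// mulr_ge0// ltW.
have e00 : 0 < e0 by rewrite invr_gt0.
(* Comes from [2 * L * b ^+ 3 * eps ^+ 2 / d] with [eps ^+ 2] at most [4 * s2 * ellmax / n]. *)
pose rC := 8 * L * b ^+ 3 * s2 * ellmax / d%:R.
exists (fun n => rC / n%:R); split.
  apply: littleo_invn_invsqrt.
  by rewrite /rC divr_ge0 ?(ltW d0)// !mulr_ge0 ?exprn_ge0 ?(ltW s20).
(* Beyond [Q], [eps] is at most [e0]; the successor in the threshold below also ensures that [n] is
   positive. *)
pose Q := 4 * s2 * ellmax / e0 ^+ 2.
have Q0 : 0 <= Q by rewrite divr_ge0 ?sqr_ge0 ?mulr_ge0 ?(ltW s20).
exists (Num.bound Q).+1 => n Nn _ disp Omega P X Xdraws.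
have n_gt0 : (0 < n)%N by exact: leq_trans Nn.
have n0 : 0 < n%:R :> R by rewrite ltr0n.
have nQ : Q <= n%:R.
  by rewrite (le_trans (ltW (archi_boundP Q0)))// ler_nat ltnW.
set eps := Num.sqrt _.
have eps0 : 0 <= eps := sqrtr_ge0 _.
have eps2 : eps ^+ 2 = 4 * s2 / n%:R * ell n.
  by rewrite sqr_sqrtr// mulr_ge0 ?ell0// divr_ge0 ?mulr_ge0 ?(ltW s20) ?(ltW n0).
have eps_le : eps <= e0.
  rewrite -(ler_pXn2r (isT : (0 < 2)%N)) ?nnegrE ?(ltW e00)// eps2.
  have -> : 4 * s2 / n%:R * ell n = 4 * s2 * ell n / n%:R by ring.
  rewrite ler_pdivrMr// [leRHS]mulrC.
  apply: (@le_trans _ _ (Q * e0 ^+ 2)); last by rewrite ler_wpM2r ?sqr_ge0.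
  rewrite /Q divfK ?expf_neq0 ?gt_eqF// ler_wpM2l ?ell_le//.
  by rewrite mulr_ge0// ltW.
have e0_le c : 0 <= c -> c <= 2 * b + 3 * C / (2 * s2) + 1 -> c * eps <= 1.
  move=> c0 cle; rewrite (le_trans (ler_wpM2l c0 eps_le))//.
  by rewrite ler_pdivrMr// mul1r.
have sC0 : 0 <= 3 * C / (2 * s2) by rewrite divr_ge0 ?mulr_ge0 ?(ltW s20).
have be : b * eps <= 2^-1.
  have := @e0_le (2 * b); rewrite mulr_ge0// => /(_ isT).
  rewrite -addrA lerDl addr_ge0// => /(_ isT); lra.
(* The minimiser of [lam ^+ 2 * s2 - lam * eps]; [n] times the minimum is [- ell n]. *)
pose lam := eps / (2 * s2).
have lam0 : 0 <= lam by rewrite divr_ge0 ?mulr_ge0 ?(ltW s20).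
have lamC k : lam * fnorm (outer x k - M) <= 3^-1.
  apply: (@le_trans _ _ (lam * C)).
    rewrite ler_wpM2l// /C (bigD1 k)//= lerDl sumr_ge0// => j _.
    exact: fnorm_ge0.
  have := @e0_le (3 * C / (2 * s2)) sC0.
  rewrite (_ : _ / _ * eps = 3 * (lam * C)); last by rewrite /lam; ring.
  have : 3 * C / (2 * s2) <= 2 * b + 3 * C / (2 * s2) + 1 by lra.
  by move=> h /(_ h); lra.
have := draws_lower_bound mu_simplex Xdraws lam0 lamC trV
  (t := n%:R * eps)
  (G := [set A | (fG_inv x (\sum_i A i) <=
     ((1 + L / d%:R * b ^+ 2 * eps + rC / n%:R) * fG_star x mu n)%:E)%E]).
have -> : n%:R * (lam ^+ 2 * s2) - lam * (n%:R * eps) = - ell n.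
  have -> : n%:R * (lam ^+ 2 * s2) - lam * (n%:R * eps) = - (n%:R * eps ^+ 2 / (4 * s2)).
    by rewrite /lam; field; rewrite gt_eqF.
  by rewrite eps2; field; rewrite !gt_eqF.
move=> bound; apply: le_trans (bound _); last first.
  move=> A Aeps; apply: (fG_inv_le mu_simplex M_unit) => //.
  rewrite eps2 /rC -/b -/L.
  have -> : 8 * L * b ^+ 3 * s2 * ellmax / d%:R / n%:R * d%:R =
      8 * L * b ^+ 3 * s2 / n%:R * ellmax by field; rewrite !gt_eqF.
  have -> : 2 * L * b ^+ 3 * (4 * s2 / n%:R * ell n) =
      8 * L * b ^+ 3 * s2 / n%:R * ell n by ring.
  by rewrite ler_wpM2l ?ell_le// divr_ge0 ?(ltW n0)// !mulr_ge0 ?exprn_ge0 ?(ltW s20).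
(* The failure probability is at most [2 * delta / dt n], hence at most [2 * delta] because [dt n]
   is at least 1. *)
rewrite lee_fin lerD2l lerN2 ler_pM2l// expRN lnK; last first.
  by rewrite posrE divr_gt0// (lt_le_trans ltr01).
by rewrite invf_div ler_pdivrMr ?(lt_le_trans ltr01)// ler_peMr// ltW.
Qed.
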